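(* Let $(P,\cdot)$ be a perm algebra over a field of characteristic $0$, and let $D_1,\dots,D_n$ be pairwise commuting derivations of $P$, i.e. $[D_i,D_j]=0$ for all $i,j$. Set $W_{\mathrm{perm}}:=\bigoplus_{i=1}^n P\,D_i$ and define a bilinear bracket on $W_{\mathrm{perm}}$ by $$[aD_i,\,bD_j]_{\circ}:=\bigl(D_j(a)\cdot b\bigr)D_i-\bigl(a\cdot D_i(b)\bigr)D_j,\qquad a,b\in P,\ i,j\in\{1,\dots,n\}.$$ Then $(W_{\mathrm{perm}},[\ ,\ ]_{\circ})$ is a (left) Leibniz algebra, i.e. for all $X,Y,Z\in W_{\mathrm{perm}}$, $$[[X,Y]_{\circ},Z]_{\circ}=[X,[Y,Z]_{\circ}]_{\circ}-[Y,[X,Z]_{\circ}]_{\circ}.$$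
   Context: A perm algebra is an associative algebra satisfying $(ab)c=(ba)c$. The space $\bigoplus_{i=1}^n P\,D_i$ is the formal direct sum of $n$ copies of the vector space $P$, where $aD_i$ denotes the element $a\in P$ placed in the $i$-th copy. *)

(* Defs.v *)
From HB Require Import structures.
From mathcomp Require Import all_boot all_order all_algebra.
Set Implicit Arguments.
Unset Strict Implicit.
Unset Printing Implicit Defensive.
Import GRing.Theory.
Local Open Scope ring_scope.

(* Algebras here are not assumed unital, so they cannot be MathComp rings or
   algType's: an algebra is a vector space together with a bilinear product. *)

Definition perm_algebra (F : fieldType) (P : lmodType F)
    (mul : {bilinear P -> P -> P}) : Prop :=
  associative mul /\
  forall a b c : P, mul (mul a b) c = mul (mul b a) c.

Definition derivation (F : fieldType) (P : lmodType F)
    (mul : {bilinear P -> P -> P}) (d : {linear P -> P}) : Prop :=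
  forall a b : P, d (mul a b) = mul (d a) b + mul a (d b).

Definition left_leibniz_algebra (F : fieldType) (L : lmodType F)
    (br : {bilinear L -> L -> L}) : Prop :=
  forall X Y Z : L, br (br X Y) Z = br X (br Y Z) - br Y (br X Z).

(* W_perm, the direct sum of n copies of P; X i is the coefficient of D_i in X.
   The sum is formal: it depends on n only, not on the derivations. *)
Notation Wperm P n := {ffun 'I_n -> P}.

(* The element a D_i. *)
Definition Wel (F : fieldType) (P : lmodType F) (n : nat) (i : 'I_n) (a : P) :
    Wperm P n :=
  [ffun j => if j == i then a else 0].

(* The bilinear extension of
     [a D_i, b D_j] = (D_j(a) b) D_i - (a D_i(b)) D_j,
   obtained by writing X = \sum_i (X i) D_i and Y = \sum_j (Y j) D_j; see
   Wbracket_el and Wel_sum below. *)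
Definition Wbracket (F : fieldType) (P : lmodType F)
    (mul : {bilinear P -> P -> P}) (n : nat) (D : 'I_n -> {linear P -> P})
    (X Y : Wperm P n) : Wperm P n :=
  \sum_i \sum_j
    (Wel i (mul (D j (X i)) (Y j)) - Wel j (mul (X i) (D i (Y j)))).

Section Wperm_facts.
Variables (F : fieldType) (P : lmodType F) (mul : {bilinear P -> P -> P}).
Variables (n : nat) (D : 'I_n -> {linear P -> P}).

Fact Wel_is_linear (i : 'I_n) : linear (@Wel F P n i).
Proof.
move=> k a b; apply/ffunP => j; rewrite !ffunE.
by case: eqP => _ //; rewrite scaler0 addr0.
Qed.

HB.instance Definition _ (i : 'I_n) :=
  GRing.isLinear.Build F P (Wperm P n) _ (@Wel F P n i) (Wel_is_linear i).

Lemma Wel_sum (X : Wperm P n) : X = \sum_i Wel i (X i).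
Proof.
apply/ffunP => j; rewrite sum_ffunE (bigD1 j) //= ffunE eqxx big1 ?addr0 //.
by move=> i /negPf neq; rewrite ffunE eq_sym neq.
Qed.

Fact Wbracket_is_bilinear :
  bilinear_for (GRing.Scale.Law.clone _ _ *:%R _)
    (GRing.Scale.Law.clone _ _ *:%R _) (Wbracket mul D).
Proof.
split=> [Y|X] k U V /=; rewrite /Wbracket scaler_sumr -big_split /=;
  apply: eq_bigr => i _; rewrite scaler_sumr -big_split /=;
  apply: eq_bigr => j _; rewrite !ffunE.
- by rewrite (linearP (D j)) !linearPl !linearP [in RHS]scalerDr addrACA.
- by rewrite (linearP (D i)) !linearPr !linearP [in RHS]scalerDr addrACA.
Qed.

HB.instance Definition _ := bilinear_isBilinear.Build F
  (Wperm P n) (Wperm P n) (Wperm P n) _ _ (Wbracket mul D)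
  Wbracket_is_bilinear.

Lemma Wbracket_el (i j : 'I_n) (a b : P) :
  Wbracket mul D (Wel i a) (Wel j b)
  = Wel i (mul (D j a) b) - Wel j (mul a (D i b)).
Proof.
rewrite /Wbracket (bigD1 i) //= (bigD1 j) //= !ffunE !eqxx.
rewrite big1 ?addr0 => [|l /negPf nl]; last first.
  by rewrite !ffunE nl !(linear0, linear0r, addr0).
rewrite big1 ?addr0 // => k /negPf nk; apply: big1 => l _.
by rewrite !ffunE nk !(linear0, linear0l, addr0).
Qed.

End Wperm_facts.

(* Main.v *)
(* By trilinearity it suffices to treat X = a D_i, Y = b D_j, Z = c D_k. Both
   sides are then sums of products of three elements, which agree by the Leibniz
   rule, the commutation of the D_i, and left-commutativity x(yz) = y(xz). *)
Require Import Defs.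
From HB Require Import structures.
From mathcomp Require Import all_boot all_order all_algebra.
Set Implicit Arguments.
Unset Strict Implicit.
Unset Printing Implicit Defensive.
Import GRing.Theory.
Local Open Scope ring_scope.

(** Both sides are additive in each argument, so the sums are split one at a time: [X] with [Y] and
    [Z] kept whole, then [Y] against a single [x i], then [Z]. *)
Lemma leibniz_sums (F : fieldType) (L : lmodType F)
    (br : {bilinear L -> L -> L}) (I : finType) (x y z : I -> L) :
    (forall i j k, br (br (x i) (y j)) (z k)
       = br (x i) (br (y j) (z k)) - br (y j) (br (x i) (z k))) ->
  let X := \sum_i x i in let Y := \sum_j y j in let Z := \sum_k z k in
  br (br X Y) Z = br X (br Y Z) - br Y (br X Z).
Proof.
move=> leib X Y Z; rewrite /X.
elim/big_ind: _ => [|U V IHU IHV|i _].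
- by rewrite !(linear0l, linear0r) subrr.
- rewrite !(linearDl br) /= (linearDr br) /= IHU IHV.
  by rewrite opprD addrACA.
rewrite /Y; elim/big_ind: _ => [|U V IHU IHV|j _].
- by rewrite !(linear0l, linear0r) subrr.
- rewrite (linearDr br) /= !(linearDl br) /= (linearDr br) /= IHU IHV.
  by rewrite opprD addrACA.
rewrite /Z; elim/big_ind: _ => [|U V IHU IHV|k _]; last exact: leib.
- by rewrite !(linear0l, linear0r) subrr.
- by rewrite !(linearDr br) /= IHU IHV opprD addrACA.
Qed.

Lemma Wbracket_leibniz_el (F : fieldType) (P : lmodType F)
    (mul : {bilinear P -> P -> P}) (permP : perm_algebra mul)
    (n : nat) (D : 'I_n -> {linear P -> P})
    (derD : forall i : 'I_n, derivation mul (D i))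
    (commD : forall (i j : 'I_n) (a : P), D i (D j a) = D j (D i a))
    (i j k : 'I_n) (a b c : P) :
  let br := Wbracket mul D in
  br (br (Wel i a) (Wel j b)) (Wel k c)
  = br (Wel i a) (br (Wel j b) (Wel k c))
    - br (Wel j b) (br (Wel i a) (Wel k c)).
Proof.
case: permP => mulA mulC /=.
have mulCA x y z : mul x (mul y z) = mul y (mul x z) by rewrite !mulA mulC.
rewrite !Wbracket_el !(linearBl, linearBr) /= !Wbracket_el.
rewrite !derD !linearDl !linearDr /= -!mulA ![Wel _ (_ + _)]linearD /=.
(* Normal form for iterated derivations: [D i] outside [D j] outside [D k]. *)
rewrite !(commD k) (commD j i).
(* Every triple product now has its factor from [a] first, from [b] second, from [c] last. *)
rewrite !(mulCA b) (mulCA (D i b)) (mulCA (D k b)).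
rewrite !opprD !opprK !addrA.
(* Of the twelve terms on the right, the first six listed are those of the left, in order; the rest
   cancel in the pairs [6*12], [9*4], [10*3]. *)
by rewrite [RHS](ACl (8*1*11*7*2*5*6*12*9*4*10*3)) /= !addrK.
Qed.

Theorem proposition6p2 (F : fieldType) (charF0 : [pchar F] =i pred0)
    (P : lmodType F) (mul : {bilinear P -> P -> P}) (permP : perm_algebra mul)
    (n : nat) (D : 'I_n -> {linear P -> P})
    (derD : forall i : 'I_n, derivation mul (D i))
    (commD : forall (i j : 'I_n) (a : P), D i (D j a) - D j (D i a) = 0) :
  left_leibniz_algebra (Wbracket mul D).
Proof.
(* Expanding into components reduces the identity to single elements [Wel i a]. *)
move=> X Y Z; rewrite (Wel_sum X) (Wel_sum Y) (Wel_sum Z).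
apply: leibniz_sums => i j k; apply: Wbracket_leibniz_el => // r s x.
by apply/eqP; rewrite -subr_eq0 commD.
Qed.
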